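(* Let the single-mode input be a finite superposition of number states and coherent states, $$|\psi\rangle=\frac1{\mathcal{N}}\left(\sum_{n=0}^Nc_n|n\rangle+\sum_{k=0}^{r-1}d_k|\alpha_k\rangle\right),$$ where $|n\rangle$ are number states, $N$ is the highest photon number in the first sum ($c_N\neq0$), $|\alpha_0\rangle,\ldots,|\alpha_{r-1}\rangle$ are distinct coherent states, $d_k\neq0$ for all $k$, and $\mathcal{N}$ is a normalization factor. Let $$|\Psi\rangle=\frac1{\mathcal{N}}\left(\sum_{n=0}^Nc_n|\Psi_n\rangle+\sum_{k=0}^{r-1}d_k|\beta_k\rangle^{\otimes m}\right),\qquad \beta_k=\alpha_k/\sqrt m,$$ be the output of a balanced $m$-port beam-splitter with input $|\psi\rangle\otimes|0,\ldots,0\rangle$. Then $|\Psi\rangle$ is SLOCC-equivalent to the state $$|\Phi_N\rangle+\sum_{n=N+1}^{N+r}|n\rangle^{\otimes m}.$$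
   Context: The state space is $\mathcal{H}=\mathcal{H}_1\otimes\cdots\otimes\mathcal{H}_m$, the space of $m\ge2$ optical modes, each mode space $\mathcal{H}_k$ having orthonormal number basis $|0\rangle,|1\rangle,|2\rangle,\ldots$; write $|n_1\ldots n_m\rangle=|n_1\rangle\otimes\cdots\otimes|n_m\rangle$. For $\alpha\in\mathbb{C}$ the coherent state is $|\alpha\rangle=e^{-|\alpha|^2/2}\sum_{n\ge0}\frac{\alpha^n}{\sqrt{n!}}|n\rangle$; kets labelled by $\alpha_k,\beta_k$ are coherent states. For $n\ge 0$ define $$|\Psi_n\rangle=\frac{1}{m^{n/2}}\sum_{n_1+\cdots+n_m=n}\sqrt{\binom{n}{n_1,\ldots,n_m}}\,|n_1\ldots n_m\rangle,\qquad |\Phi_n\rangle=\sum_{n_1+\cdots+n_m=n}|n_1\ldots n_m\rangle,$$ where the sums run over all tuples of non-negative integers with sum $n$ and $\binom{n}{n_1,\ldots,n_m}=\frac{n!}{n_1!\cdots n_m!}$. A balanced $m$-port beam-splitter is represented by a unitary $U_S$ which fixes the vacuum and satisfies $U_Sa_1^\dagger U_S^\dagger=(a_1^\dagger+\cdots+a_m^\dagger)/\sqrt m$, where $a_k^\dagger$ is the creation operator of mode $k$; it maps $|n,0,\ldots,0\rangle$ to $|\Psi_n\rangle$ and $|\alpha\rangle\otimes|0,\ldots,0\rangle$ to $|\alpha/\sqrt m\rangle^{\otimes m}$. Two (possibly unnormalized) pure states $|\Psi\rangle,|\Phi\rangle$ are SLOCC-equivalent if there are invertible local operators $A_k$ on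 $\mathcal{H}_k$, $k=1,\ldots,m$, with $|\Phi\rangle=A_1\otimes\cdots\otimes A_m|\Psi\rangle$.
   Formalization: All coherent amplitudes α_k are assumed nonzero; if some α_k=0, that coherent state is the number state |0⟩ and the claim fails (e.g. N=0, r=1, α_0=0 gives a product output but an entangled target). *)

(* Defs.v *)
From HB Require Import structures.
From mathcomp Require Import all_boot all_order all_algebra.
From mathcomp Require Import complex.
From mathcomp Require Import finmap ring lra.
From mathcomp Require Import boolp classical_sets functions cardinality fsbigop.
From mathcomp Require Import reals ereal topology normedtype sequences esum exp.

Set Implicit Arguments.
Unset Strict Implicit.
Unset Printing Implicit Defensive.

Import Order.TTheory GRing.Theory Num.Theory.
Import ComplexField Normc.

Local Open Scope classical_set_scope.
Local Open Scope ring_scope.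
Local Open Scope complex_scope.

Section SquareSummable.
Variables (R : realType) (I : choiceType).
Implicit Types u v : I -> R[i].

Definition sqnorm v : \bar R := \esum_(i in [set: I]) (normc (v i) ^+ 2)%:E.

Definition square_summable v : bool := (sqnorm v < +oo)%E.

Lemma square_summableP v :
  reflect (exists M : R, forall s : seq I, uniq s ->
             \sum_(i <- s) normc (v i) ^+ 2 <= M)
          (square_summable v).
Proof.
have sq0 i : 0 <= normc (v i) ^+ 2 by exact: sqr_ge0.
apply: (iffP idP) => [fin|[M hM]].
  exists (fine (sqnorm v)) => s us.
  have fn : (sqnorm v \is a fin_num)%E.
    by rewrite ge0_fin_numE// esum_ge0// => i _; rewrite lee_fin.
  rewrite -lee_fin fineK//; apply: esum_ge; exists [set` s].
    by split => //; exact: finite_seq.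
  by rewrite -fsbig_seq// sumEFin.
apply: (@le_lt_trans _ _ M%:E); last exact: ltry.
apply: ge_ereal_sup => _ [X [finX _] <-].
rewrite fsbig_finite//= sumEFin lee_fin.
exact/hM/fset_uniq.
Qed.

Lemma square_summable_submod : GRing.submod_closed square_summable.
Proof.
split.
  apply/square_summableP; exists 0 => s _; rewrite big1// => i _.
  by rewrite normc0 expr0n.
move=> a u v /square_summableP[M hM] /square_summableP[M' hM'].
apply/square_summableP; exists (normc a ^+ 2 * M *+ 2 + M' *+ 2) => s us.
have h i : normc ((a *: u + v) i) ^+ 2 <=
    normc a ^+ 2 * normc (u i) ^+ 2 *+ 2 + normc (v i) ^+ 2 *+ 2.
  have h0 : 0 <= normc ((a *: u + v) i).
    by rewrite /normc; case: (_ i) => *; rewrite sqrtr_ge0.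
  have h1 := le_normcD (a * u i) (v i).
  apply: (le_trans (lerXn2r 2 h0 (le_trans h0 h1) h1)).
  rewrite normcM -exprMn; set x := _ * _; set y := normc _.
  rewrite -subr_ge0 (_ : _ - _ = (x - y) ^+ 2) ?sqr_ge0//.
  by rewrite sqrrB sqrrD !mulr2n opprD opprD !addrA; ring.
apply: (le_trans (ler_sum _ (fun i _ => h i))).
rewrite big_split/= !sumrMnl -mulr_sumr.
by rewrite lerD// lerMn2r ?hM'// ler_wpM2l ?hM// sqr_ge0.
Qed.

End SquareSummable.

HB.instance Definition _ (R : realType) (I : choiceType) :=
  GRing.isSubmodClosed.Build R[i] (I -> R[i]) (@square_summable R I)
    (@square_summable_submod R I).

Section Ell2.
Variables (R : realType) (I : choiceType).

Record ell2 := Ell2 {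
  ell2_fun :> I -> R[i];
  ell2P : ell2_fun \in @square_summable R I }.

HB.instance Definition _ := [isSub for ell2_fun].
HB.instance Definition _ := [Choice of ell2 by <:].
HB.instance Definition _ := [SubChoice_isSubLmodule of ell2 by <:].

Definition l2norm (v : ell2) : R := Num.sqrt (fine (sqnorm v)).

End Ell2.

Section Operators.
Variables (R : realType) (I J : choiceType).

(* Local operators on the infinite-dimensional mode spaces are taken bounded, *)
(* invertible ones with bounded inverse; otherwise their tensor product would *)
(* not be defined on the Hilbert-space tensor product.                        *)
Definition bounded_op (A : {linear ell2 R I -> ell2 R J}) :=
  exists M : R, forall v, l2norm (A v) <= M * l2norm v.

End Operators.

Definition invertible_op (R : realType) (I J : choiceType)
    (A : {linear ell2 R I -> ell2 R J}) :=
  bounded_op A /\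
  exists B : {linear ell2 R J -> ell2 R I},
    [/\ bounded_op B, cancel A B & cancel B A].

Section States.
Variable R : realType.

Lemma ler_sum_subseq (T : eqType) (s s' : seq T) (F : T -> R) :
  uniq s -> uniq s' -> {subset s <= s'} -> (forall t, 0 <= F t) ->
  \sum_(t <- s) F t <= \sum_(t <- s') F t.
Proof.
move=> us us' ss' F0.
have e : perm_eq s [seq t <- s' | t \in s].
  apply: uniq_perm => // [|t]; first exact: filter_uniq.
  by rewrite mem_filter; case: (boolP (t \in s)) => //= /ss' ->.
rewrite (perm_big _ e)/= big_filter big_mkcond/=.
by apply: ler_sum => t _; case: ifP.
Qed.

Lemma fock_subproof (n : nat) :
  (fun j => (j == n)%:R : R[i]) \in @square_summable R nat.
Proof.
apply/square_summableP; exists 1 => s us.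
apply: (@le_trans _ _
    (\sum_(j <- undup (n :: s)) normc ((j == n)%:R : R[i]) ^+ 2)).
  apply: ler_sum_subseq; rewrite ?undup_uniq//.
  - by move=> t ts; rewrite mem_undup inE ts orbT.
  - by move=> t; rewrite sqr_ge0.
rewrite (bigD1_seq n) ?undup_uniq ?mem_undup ?mem_head//=.
rewrite eqxx normc1 expr1n big1 ?addr0// => j /negPf ->.
by rewrite normc0 expr0n.
Qed.

Definition fock (n : nat) : ell2 R nat := Ell2 (fock_subproof n).

Definition coherent_coef (alpha : R[i]) (n : nat) : R[i] :=
  (expR (- normc alpha ^+ 2 / 2))%:C * (alpha ^+ n / (Num.sqrt n`!%:R)%:C).

Lemma coherent_subproof (alpha : R[i]) :
  coherent_coef alpha \in @square_summable R nat.
Proof.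
set x := normc alpha ^+ 2; set c := expR (- x / 2).
have x0 : 0 <= x by exact: sqr_ge0.
have nR (y : R) : normc y%:C ^+ 2 = y ^+ 2.
  by rewrite /normc/= expr0n addr0 sqr_sqrtr ?sqr_ge0.
apply/square_summableP; exists (c ^+ 2 * expR x) => s us.
have -> : \sum_(i <- s) normc (coherent_coef alpha i) ^+ 2 =
    c ^+ 2 * \sum_(i <- s) exp_coeff x i.
  rewrite mulr_sumr; apply: eq_bigr => i _.
  rewrite /coherent_coef !(normcM, normcV) !exprMn nR exprVn nR.
  rewrite sqr_sqrtr ?ler0n// /exp_coeff/=; congr (_ * (_ / _)).
  rewrite -exprM mulnC exprM; congr (_ ^+ _).
  by elim: i => [|i ih]; rewrite ?expr0 ?normc1// !exprS normcM ih.
rewrite ler_wpM2l ?sqr_ge0//.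
pose N := (\max_(i <- s) i).+1.
apply: (@le_trans _ _ (series (exp_coeff x) N)).
  rewrite /series/=; apply: ler_sum_subseq; rewrite ?iota_uniq//.
  - by move=> i si; rewrite mem_index_iota ltnS /=; apply: leq_bigmax_seq.
  - by move=> i; exact: exp_coeff_ge0.
apply: nondecreasing_cvgn_le; last exact: is_cvg_series_exp_coeff.
apply/nondecreasing_seqP => n; rewrite /series/= big_nat_recr//= lerDl.
exact: exp_coeff_ge0.
Qed.

(* [coherent 0 = fock 0]: the vacuum is both a coherent and a number state.  *)
(* A superposition of number states and coherent states has a well-defined    *)
(* coherent part only if amplitude 0 is excluded from the latter.             *)
Definition coherent (alpha : R[i]) : ell2 R nat :=
  Ell2 (coherent_subproof alpha).

Variable m : nat.

(* The Hilbert-space tensor product of m copies of l^2(N), as l^2(N^m).       *)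
Definition modes := ell2 R {ffun 'I_m -> nat}.

Lemma tensor_subproof (x : 'I_m -> ell2 R nat) :
  (fun t : {ffun 'I_m -> nat} => \prod_(k < m) x k (t k))
    \in @square_summable R {ffun 'I_m -> nat}.
Proof.
have sq0 (z : R[i]) : 0 <= normc z ^+ 2 by exact: sqr_ge0.
have /choice[M hM] (k : 'I_m) : exists M : R, forall s : seq nat, uniq s ->
    \sum_(i <- s) normc (x k i) ^+ 2 <= M.
  exact/square_summableP/ell2P.
apply/square_summableP; exists (\prod_k M k) => s us.
pose B := \max_(t <- s) \max_(k < m) t k.
pose up (u : {ffun 'I_m -> 'I_B.+1}) : {ffun 'I_m -> nat} :=
  [ffun k => val (u k)].
have up_inj : injective up.
  move=> u v /ffunP e; apply/ffunP => k; apply: val_inj.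
  by have := e k; rewrite !ffunE.
pose s' := [seq up u | u <- enum {: {ffun 'I_m -> 'I_B.+1}}].
have nprod (t : {ffun 'I_m -> nat}) : normc (\prod_(k < m) x k (t k)) ^+ 2 =
    \prod_(k < m) normc (x k (t k)) ^+ 2.
  elim/big_rec2: _ => [|k y z _ <-]; first by rewrite normc1 expr1n.
  by rewrite normcM exprMn.
apply: (@le_trans _ _
    (\sum_(t <- s') normc (\prod_(k < m) x k (t k)) ^+ 2)).
  apply: ler_sum_subseq => // [|t ts]; first by rewrite map_inj_uniq ?enum_uniq.
  apply/mapP; exists [ffun k => inord (t k)]; first by rewrite mem_enum.
  apply/ffunP => k; rewrite !ffunE/= inordK// ltnS.
  apply: leq_trans (leq_bigmax_seq _ ts isT).
  exact: (leq_bigmax k).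
rewrite big_map big_enum/=; under eq_bigr do rewrite nprod.
rewrite (eq_bigr (fun u : {ffun 'I_m -> 'I_B.+1} =>
    \prod_(k < m) normc (x k (val (u k))) ^+ 2)); last first.
  by move=> u _; apply: eq_bigr => k _; rewrite ffunE.
rewrite -(bigA_distr_bigA (fun k (j : 'I_B.+1) => normc (x k (val j)) ^+ 2)).
apply: ler_prod => k _; rewrite sumr_ge0//=.
rewrite -(big_mkord xpredT (fun j => normc (x k j) ^+ 2)).
by rewrite hM ?iota_uniq.
Qed.

Definition tensor (x : 'I_m -> ell2 R nat) : modes := Ell2 (tensor_subproof x).

Definition ket (t : {ffun 'I_m -> nat}) : modes :=
  tensor (fun k => fock (t k)).

(* The tuples [t] of sum [n] all have entries at most [n], so they range over *)
(* the finite type ['I_m -> 'I_n.+1].                                         *)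
Definition Psi (n : nat) : modes :=
  ((Num.sqrt (m%:R ^+ n))%:C)^-1 *:
  \sum_(t : {ffun 'I_m -> 'I_n.+1} | (\sum_k val (t k))%N == n)
     (Num.sqrt (n`!%:R / (\prod_k (val (t k))`!)%N%:R))%:C *:
       ket [ffun k => val (t k)].

Definition Phi (n : nat) : modes :=
  \sum_(t : {ffun 'I_m -> 'I_n.+1} | (\sum_k val (t k))%N == n)
     ket [ffun k => val (t k)].

(* The formula of the (unbounded) creation operator of mode [k], as an        *)
(* operation on all functions: <t|a_k^dagger v> = sqrt(t_k) <t - e_k|v>.      *)
(* The truncated [t_k - 1] is harmless since the factor vanishes at t_k = 0.  *)
Definition creation (k : 'I_m) (v : {ffun 'I_m -> nat} -> R[i]) :
    {ffun 'I_m -> nat} -> R[i] :=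
  fun t => (Num.sqrt (t k)%:R)%:C * v [ffun l => (t l - (l == k))%N].

(* [V] is the adjoint of the unitary [U].  The equation                       *)
(* U a_1^dagger U^dagger = (a_1^dagger + ... + a_m^dagger) / sqrt m           *)
(* is required on the vectors [v] such that [V v] is in the domain of         *)
(* a_1^dagger, i.e. a_1^dagger (V v) is a square-summable [w].                *)
Definition balanced_beam_splitter (U : {linear modes -> modes}) :=
  exists V : {linear modes -> modes},
    [/\ cancel U V /\ cancel V U,
        forall v, l2norm (U v) = l2norm v,
        U (ket [ffun=> 0%N]) = ket [ffun=> 0%N] &
        forall (k1 : 'I_m) (v w : modes), val k1 = 0%N ->
          (w : {ffun 'I_m -> nat} -> R[i]) = creation k1 (V v) ->
          (U w : {ffun 'I_m -> nat} -> R[i]) =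
            ((Num.sqrt m%:R)%:C)^-1 *: \sum_(k < m) creation k v].

(* Product vectors span a dense subspace, so a bounded [T] is determined by   *)
(* its values on them: [T] is the operator A_1 (x) ... (x) A_m.               *)
Definition is_tensor_op (A : 'I_m -> {linear ell2 R nat -> ell2 R nat})
    (T : {linear modes -> modes}) :=
  bounded_op T /\ forall x, T (tensor x) = tensor (fun k => A k (x k)).

Definition slocc_equivalent (v w : modes) :=
  exists (A : 'I_m -> {linear ell2 R nat -> ell2 R nat})
         (T : {linear modes -> modes}),
    [/\ forall k, invertible_op (A k), is_tensor_op A T & w = T v].

End States.

Arguments fock {R} n.
Arguments ket {R m} t.
Arguments Psi {R} m n.
Arguments Phi {R} m n.

(* Main.v *)
From HB Require Import structures.
Require Import Defs.
From mathcomp Require Import all_boot all_order all_algebra.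
From mathcomp Require Import complex.
From mathcomp Require Import finmap ring lra.
From mathcomp Require Import boolp classical_sets fsbigop.
From mathcomp Require Import reals ereal sequences esum exp.

(* An operator that differs from the identity by a finite-rank one, acting on *)
(* the first [n] coordinates, is invertible as soon as the images of the      *)
(* first [n] number states have an invertible [n x n] block.  For             *)
(* [n = N + 1 + r] such an operator can send [|j>], [j <= N], to              *)
(* [|j> / sqrt j!] and the next [r] number states to the coherent states      *)
(* [|beta_k>]: the block is triangular with a Vandermonde corner.  On         *)
(* [Phi_j] this produces [Psi_j] up to a scalar.  The number part             *)
(* [sum_n c_n Psi_n] is obtained from [Phi_N] alone, since lowering one       *)
(* chosen mode by [l] turns [Phi_N] into [Phi_(N-l)]: a Toeplitz factor on    *)
(* that mode, invertible because [c_N != 0], supplies all the coefficients,   *)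
(* and the [d_k] are absorbed on the same mode.                               *)
(* For the beam splitter, number states are handled by induction with the     *)
(* creation operators, and coherent states as limits of number states.        *)

Set Implicit Arguments.
Unset Strict Implicit.
Unset Printing Implicit Defensive.

Import Order.TTheory GRing.Theory Num.Theory.
Import ComplexField Normc.
Local Open Scope ring_scope.
Local Open Scope complex_scope.

(* Otherwise simplification turns sums in [ell2] into sums of functions. *)
Local Arguments ell2_fun {R I} _ _ : simpl never.

(** The output is rewritten as a sum of product vectors whose factors in mode [k] are taken from
    vectors [u k j], [j < N + 1 + r], and the local operator on mode [k] is one that sends [u k j]
    to |j>. By [sqrtC_multinomial], the amplitude of Psi_S at s, with S the sum of the s_k, is
    sqrt(S!) / m^(S/2) times the product of the 1 / sqrt(s_k!). Hence summing the products of the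
    |t_k> / sqrt(t_k!) over all t of sum N gives a multiple of Psi_N. If on one mode [k0] the vector
    |j> / sqrt(j!) is replaced by the sum over i <= j of p(j-i) |i> / sqrt(i!), the amplitude at s
    becomes p(N-S) times the product of the 1 / sqrt(s_k!) for S <= N, and 0 otherwise
    ([sum_tensor_slocc_basis]); a suitable p then gives the whole number part. The coherent terms
    are product vectors already and supply the last r vectors [u k j]. [slocc_basis_unitmx] and
    [invertible_op_basis] provide the local operators, [tensor_op] their tensor product, and
    [slocc_equivalent_Phi] combines them. The shape of the output itself comes from
    [beam_splitter_fock] and [beam_splitter_coherent]. *)

(** * Norms and coordinates in l^2 *)

Lemma normc_ge0 (R : realType) (z : R[i]) : 0 <= normc z.
Proof. by case: z => a b; rewrite sqrtr_ge0. Qed.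

Lemma normc_real (R : realType) (x : R) : normc x%:C = `|x|.
Proof. by rewrite /normc/= expr0n addr0 sqrtr_sqr. Qed.

Lemma sqr_normcD_le (R : realType) (z w : R[i]) :
  normc (z + w) ^+ 2 <= normc z ^+ 2 *+ 2 + normc w ^+ 2 *+ 2.
Proof.
apply: le_trans (lerXn2r 2 _ _ (le_normcD z w)) _;
  rewrite ?nnegrE ?addr_ge0 ?normc_ge0//.
have := sqr_ge0 (normc z - normc w); rewrite !mulr2n; nra.
Qed.

(** With [l2norm_sqr_le], this replaces the extended-real sum behind [l2norm] by its finite partial
    sums; the norm estimates below rest on these two bounds. *)
Lemma sum_sqr_le_l2norm (R : realType) (I : choiceType) (v : ell2 R I)
    (s : seq I) :
  uniq s -> \sum_(i <- s) normc (v i) ^+ 2 <= l2norm v ^+ 2.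
Proof.
move=> us.
have sq0 i : (0 <= (normc (v i) ^+ 2)%:E)%E by rewrite lee_fin sqr_ge0.
have fn : (sqnorm v \is a fin_num)%E.
  by rewrite ge0_fin_numE ?esum_ge0//; exact: (ell2P v).
rewrite sqr_sqrtr; last by rewrite fine_ge0// esum_ge0.
rewrite -lee_fin fineK//; apply: esum_ge; exists [set` s]%classic.
  by split => //; exact: finite_seq.
by rewrite -fsbig_seq// sumEFin.
Qed.

Lemma l2norm_sqr_le (R : realType) (I : choiceType) (v : ell2 R I) (M : R) :
  (forall s : seq I, uniq s -> \sum_(i <- s) normc (v i) ^+ 2 <= M) ->
  l2norm v ^+ 2 <= M.
Proof.
move=> hM.
have sq0 i : (0 <= (normc (v i) ^+ 2)%:E)%E by rewrite lee_fin sqr_ge0.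
have fn : (sqnorm v \is a fin_num)%E.
  by rewrite ge0_fin_numE ?esum_ge0//; exact: (ell2P v).
rewrite sqr_sqrtr; last by rewrite fine_ge0// esum_ge0.
rewrite -lee_fin fineK//; apply: ge_ereal_sup => _ [X [finX _] <-].
by rewrite fsbig_finite//= sumEFin lee_fin; exact/hM/fset_uniq.
Qed.

Lemma l2norm_ge0 (R : realType) (I : choiceType) (v : ell2 R I) :
  0 <= l2norm v.
Proof. exact: sqrtr_ge0. Qed.

Lemma sqr_normc_le_l2norm (R : realType) (I : choiceType) (v : ell2 R I) i :
  normc (v i) ^+ 2 <= l2norm v ^+ 2.
Proof. by have := @sum_sqr_le_l2norm _ _ v [:: i] isT; rewrite big_seq1. Qed.

Lemma ell2_eq (R : realType) (I : choiceType) (v w : ell2 R I) :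
  (forall i, v i = w i) -> v = w.
Proof. by move=> h; apply: val_inj; apply: funext. Qed.

Lemma ell2E (R : realType) (I : choiceType) :
  (forall i, (0 : ell2 R I) i = 0) *
  (forall (v w : ell2 R I) i, (v + w) i = v i + w i) *
  (forall (v : ell2 R I) i, (- v) i = - v i) *
  (forall a (v : ell2 R I) i, (a *: v) i = a * v i).
Proof. by []. Qed.

Lemma ell2_sumE (R : realType) (I : choiceType) (T : Type) (s : seq T)
    (P : pred T) (f : T -> ell2 R I) i :
  (\sum_(t <- s | P t) f t) i = \sum_(t <- s | P t) f t i.
Proof. by elim/big_rec2: _ => // t x y _ <-; rewrite ell2E. Qed.

(** * Bounded operators given by coordinate formulas *)

(* The values of [B] are not yet known to be square summable. *)
Definition l2_bounded (R : realType) (I J : choiceType)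
    (B : ell2 R I -> J -> R[i]) :=
  exists2 K : R, 0 <= K & forall v s, uniq s ->
    \sum_(j <- s) normc (B v j) ^+ 2 <= K * l2norm v ^+ 2.

Lemma l2_boundedD (R : realType) (I J : choiceType)
    (B C : ell2 R I -> J -> R[i]) :
  l2_bounded B -> l2_bounded C -> l2_bounded (fun v j => B v j + C v j).
Proof.
move=> [K K0 hB] [L L0 hC]; exists (K *+ 2 + L *+ 2) => [|v s us].
  by rewrite addr_ge0// mulrn_wge0.
apply: le_trans (ler_sum _ (fun j _ => sqr_normcD_le _ _)) _.
rewrite big_split/= !sumrMnl mulrDl !mulrnAl.
by rewrite lerD// lerMn2r/= ?hB ?hC.
Qed.

Lemma l2_bounded_sum (R : realType) (I J : choiceType) (T : Type) (s : seq T)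
    (B : T -> ell2 R I -> J -> R[i]) :
  (forall t, l2_bounded (B t)) ->
  l2_bounded (fun v j => \sum_(t <- s) B t v j).
Proof.
move=> hB; elim: s => [|t s ih].
  exists 0 => // v s us; rewrite mul0r big1// => j _.
  by rewrite big_nil normc0 expr0n.
suff -> : (fun v j => \sum_(u <- t :: s) B u v j) =
    (fun v j => B t v j + \sum_(u <- s) B u v j) by exact: l2_boundedD.
by apply/funext => v; apply/funext => j; rewrite big_cons.
Qed.

Lemma l2_bounded_id (R : realType) (I : choiceType) :
  @l2_bounded R I I (fun v => v).
Proof. by exists 1 => // v s us; rewrite mul1r sum_sqr_le_l2norm. Qed.

Lemma l2_bounded_op (R : realType) (I J : choiceType)
    (B : ell2 R I -> J -> R[i]) :
  (forall a v w j, B (a *: v + w) j = a * B v j + B w j) -> l2_bounded B ->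
  exists2 A : {linear ell2 R I -> ell2 R J},
    bounded_op A & forall v j, A v j = B v j.
Proof.
move=> linB [K K0 hB].
have B2 v : B v \in @square_summable R J.
  by apply/square_summableP; exists (K * l2norm v ^+ 2); exact: hB.
pose f v : ell2 R J := Ell2 (B2 v).
have linf : linear f by move=> a v w; apply: ell2_eq => j; exact: linB.
pose fM := GRing.isLinear.Build _ _ _ _ f linf.
pose A : {linear ell2 R I -> ell2 R J} := HB.pack f fM.
exists A => //; exists (Num.sqrt K) => v.
rewrite -(@ler_pXn2r _ 2) ?nnegrE ?mulr_ge0 ?sqrtr_ge0 ?l2norm_ge0//.
by rewrite exprMn (sqr_sqrtr K0); apply: l2norm_sqr_le => s us; exact: hB.
Qed.

Lemma bounded_op_id (R : realType) (I : choiceType) :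
  @bounded_op R I I idfun.
Proof. by exists 1 => v; rewrite mul1r. Qed.

Lemma bounded_op_comp (R : realType) (I J K : choiceType)
    (A : {linear ell2 R J -> ell2 R K}) (B : {linear ell2 R I -> ell2 R J}) :
  bounded_op A -> bounded_op B -> bounded_op (A \o B : {linear _ -> _}).
Proof.
move=> [M hM] [L hL]; exists (Num.max M 0 * L) => v /=.
apply: le_trans (hM _) _.
apply: (@le_trans _ _ (Num.max M 0 * l2norm (B v))).
  by rewrite ler_wpM2r ?l2norm_ge0// le_max lexx.
by rewrite -mulrA ler_wpM2l ?hL// le_max lexx orbT.
Qed.

Definition ffun_upd (m : nat) (t : {ffun 'I_m -> nat}) (k : 'I_m) (j : nat) :
  {ffun 'I_m -> nat} := [ffun l => if l == k then j else t l].

(** The tuple t can be recovered from the pair of [t k] and [ffun_upd t k j], so the sum is part of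
    a double sum that factors into one for [g] and one for [v]. *)
Lemma l2_bounded_slot (R : realType) (m : nat) (k : 'I_m) (j : nat)
    (g : ell2 R nat) :
  l2_bounded (fun (v : modes R m) t => v (ffun_upd t k j) * g (t k)).
Proof.
exists (l2norm g ^+ 2) => [|v s us]; first exact: sqr_ge0.
pose f (t : {ffun 'I_m -> nat}) := (t k, ffun_upd t k j).
have f_inj : injective f.
  move=> t u [etu /ffunP e]; apply/ffunP => l; have := e l; rewrite !ffunE.
  by case: eqP => // ->.
pose s1 := undup [seq t k | t : {ffun 'I_m -> nat} <- s].
pose s2 := undup [seq ffun_upd t k j | t : {ffun 'I_m -> nat} <- s].
pose G (p : nat * {ffun 'I_m -> nat}) :=
  normc (v p.2) ^+ 2 * normc (g p.1) ^+ 2.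
have -> : \sum_(t <- s) normc (v (ffun_upd t k j) * g (t k)) ^+ 2 =
    \sum_(p <- [seq f t | t <- s]) G p.
  by rewrite big_map; apply: eq_bigr => t _; rewrite normcM exprMn.
apply: (@le_trans _ _ (\sum_(p <- [seq (a, b) | a <- s1, b <- s2]) G p)).
  apply: ler_sum_subseq; rewrite ?map_inj_uniq ?allpairs_uniq ?undup_uniq//.
  - by move=> [a b] [c d].
  - move=> p /mapP[t ts ->]; apply/allpairsP; exists (f t).
    by split; rewrite ?mem_undup; first [apply/mapP; exists t|by []].
  - by move=> p; rewrite mulr_ge0 ?sqr_ge0.
rewrite big_allpairs/= (eq_bigr (fun a => normc (g a) ^+ 2 *
    \sum_(b <- s2) normc (v b) ^+ 2)); last first.
  by move=> a _; rewrite mulr_sumr; apply: eq_bigr => b _; rewrite mulrC.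
rewrite -mulr_suml ler_pM ?sumr_ge0 ?sum_sqr_le_l2norm ?undup_uniq// => *;
  exact: sqr_ge0.
Qed.

Lemma l2_bounded_coord (R : realType) (j : nat) (g : ell2 R nat) :
  l2_bounded (fun (x : ell2 R nat) i => x j * g i).
Proof.
exists (l2norm g ^+ 2) => [|v s us]; first exact: sqr_ge0.
under eq_bigr do rewrite normcM exprMn.
by rewrite -mulr_sumr mulrC ler_pM ?sumr_ge0 ?sum_sqr_le_l2norm
  ?sqr_normc_le_l2norm// ?sqr_ge0// => *; rewrite sqr_ge0.
Qed.

(** * Finite-rank perturbations of the identity, their inverses and tensor products *)

Lemma finite_rank_perturbation (R : realType) (n : nat)
    (g : 'I_n -> ell2 R nat) :
  exists2 A : {linear ell2 R nat -> ell2 R nat},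
    bounded_op A & forall x, A x = x + \sum_(j < n) x j *: g j.
Proof.
have [||A bA hA] := @l2_bounded_op R nat nat
    (fun x i => x i + \sum_(j < n) x j * g j i).
- move=> a v w i; rewrite !ell2E mulrDr addrACA mulr_sumr -big_split/=.
  by congr (_ + _); apply: eq_bigr => j _; rewrite !ell2E mulrDl mulrA.
- apply: l2_boundedD (l2_bounded_id _ _) _; apply: l2_bounded_sum => j.
  exact: l2_bounded_coord.
exists A => // x; apply: ell2_eq => i; rewrite hA ell2E ell2_sumE.
by congr (_ + _); apply: eq_bigr.
Qed.

Lemma fock_apply (R : realType) n i : fock n i = (i == n)%:R :> R[i].
Proof. by []. Qed.

Lemma tensorE (R : realType) (m : nat) (x : 'I_m -> ell2 R nat) t :
  tensor x t = \prod_(k < m) x k (t k).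
Proof. by []. Qed.

(* The Woodbury identity: with [h_j = u_j - e_j] and [M] the matrix of the *)
(* first [n] coordinates of the [u_j], the inverse of [1 + sum_j x_j h_j]  *)
(* is [1 - sum_j (M^-1 x)_j h_j].                                          *)
Lemma invertible_op_basis (R : realType) (n : nat) (u : 'I_n -> ell2 R nat) :
  \matrix_(i, j) u j i \in unitmx ->
  exists (A : {linear ell2 R nat -> ell2 R nat}) (g : 'I_n -> ell2 R nat),
    [/\ invertible_op A, forall x, A x = x + \sum_(j < n) x j *: g j &
        forall j, A (u j) = fock j].
Proof.
set M := \matrix_(i, j) _ => uM.
pose h j := u j - fock j.
pose g j := - \sum_(i < n) invmx M i j *: h i.
have [F bF hF] := finite_rank_perturbation h.
have [A bA hA] := finite_rank_perturbation g.
have hE (i j : 'I_n) : h j i = M i j - (i == j)%:R.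
  by rewrite /h !ell2E mxE fock_apply.
have sumA (x : ell2 R nat) : \sum_(j < n) x j *: g j =
    - \sum_(i < n) (\sum_(j < n) invmx M i j * x j) *: h i.
  under eq_bigr do rewrite scalerN scaler_sumr.
  rewrite sumrN exchange_big/=; congr (- _); apply: eq_bigr => i _.
  by rewrite scaler_suml; apply: eq_bigr => j _; rewrite scalerA mulrC.
have FK : cancel F A.
  move=> x; rewrite hA sumA hF -addrA -[RHS]addr0; congr (_ + _).
  apply/eqP; rewrite subr_eq0; apply/eqP; apply: eq_bigr => i _.
  congr (_ *: _).
  have e j : (x + \sum_(l < n) x l *: h l) (j : 'I_n) =
      \sum_(l < n) M j l * x l.
    rewrite ell2E ell2_sumE.
    under eq_bigr do rewrite ell2E hE mulrBr.
    rewrite sumrB [X in _ - X](bigD1 j)//= eqxx mulr1.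
    rewrite [X in _ - (_ + X)]big1 => [|l /negPf nl]; last first.
      by rewrite eq_sym nl mulr0.
    by rewrite addr0 addrC subrK; apply: eq_bigr => l _; rewrite mulrC.
  under eq_bigr do rewrite e mulr_sumr.
  rewrite exchange_big/=.
  have : (invmx M *m M) *m (\col_l x (l : 'I_n)) = \col_l x (l : 'I_n).
    by rewrite mulVmx ?mul1mx.
  move=> /matrixP/(_ i 0); rewrite !mxE => <-; apply: eq_bigr => l _.
  rewrite !mxE mulr_suml; apply: eq_bigr => j _; by rewrite mulrA.
have AK : cancel A F.
  move=> x; rewrite hF hA sumA -addrA -[RHS]addr0; congr (_ + _).
  rewrite addrC; apply/eqP; rewrite subr_eq0; apply/eqP; apply: eq_bigr => i _.
  (* The first n coordinates of A x are y = M^-1 x: subtracting M y - y from x = M y leaves y. *)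
  congr (_ *: _); set y := fun i => \sum_(j < n) invmx M i j * x j.
  rewrite ell2E ell2E ell2_sumE.
  under eq_bigr => l _ do rewrite ell2E hE mulrBr.
  rewrite sumrB [X in - (_ - X)](bigD1 i)//= eqxx mulr1.
  rewrite [X in - (_ - (_ + X))]big1 => [|l /negPf nl]; last first.
    by rewrite eq_sym nl mulr0.
  rewrite addr0 opprB addrCA -[RHS]addr0; congr (_ + _).
  apply/eqP; rewrite subr_eq0; apply/eqP.
  have : (M *m invmx M) *m (\col_l x (l : 'I_n)) = \col_l x (l : 'I_n).
    by rewrite mulmxV ?mul1mx.
  rewrite -mulmxA => /matrixP/(_ i 0); rewrite !mxE => <-.
  apply: eq_bigr => l _; rewrite !mxE mulrC; congr (_ * _).
  by apply: eq_bigr => j _; rewrite mxE.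
have Fe (j : 'I_n) : F (fock j) = u j.
  rewrite hF (bigD1 j)//= big1 => [|l nl]; last first.
    by rewrite fock_apply val_eqE (negPf nl) scale0r.
  by rewrite fock_apply eqxx scale1r addr0 /h addrC subrK.
exists A, g; split => // [|j]; last by rewrite -Fe FK.
by split => //; exists F.
Qed.

(** The finite-rank form of [A k] lets it act on mode k of any joint state by an explicit formula
    that reads finitely many values in that mode. T is the composite of these one-mode actions,
    built by induction on the list of modes already treated. *)
Lemma tensor_op (R : realType) (m n : nat)
    (A : 'I_m -> {linear ell2 R nat -> ell2 R nat})
    (g : 'I_m -> 'I_n -> ell2 R nat) :
  (forall k x, A k x = x + \sum_(j < n) x j *: g k j) ->
  exists T : {linear modes R m -> modes R m}, is_tensor_op A T.
Proof.
move=> hA.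
suff [T bT hT] : exists2 T : {linear modes R m -> modes R m}, bounded_op T &
    forall x, T (tensor x) =
      tensor (fun k => if k \in enum 'I_m then A k (x k) else x k).
  exists T; split=> // x; rewrite hT; congr tensor.
  by apply/funext => k; rewrite mem_enum.
elim: (enum 'I_m) (enum_uniq 'I_m) => [_|k s ih /= /andP[ks us]].
  by exists idfun => //; exact: bounded_op_id.
have [T bT hT] := ih us.
have [||S bS hS] := @l2_bounded_op R _ _ (fun (v : modes R m) t =>
    v t + \sum_(j < n) v (ffun_upd t k j) * g k j (t k)).
- move=> a v w t; rewrite !ell2E mulrDr addrACA mulr_sumr -big_split/=.
  by congr (_ + _); apply: eq_bigr => j _; rewrite !ell2E mulrDl mulrA.
- apply: l2_boundedD (l2_bounded_id _ _) _; apply: l2_bounded_sum => j.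
  exact: l2_bounded_slot.
exists (S \o T : {linear _ -> _}) => [|x]; first exact: bounded_op_comp.
rewrite /= hT; apply: ell2_eq => t; rewrite hS tensorE.
rewrite [LHS](_ : _ = A k (x k) (t k) * \prod_(l < m | l != k)
    (if l \in s then A l (x l) else x l) (t l)); last first.
  rewrite (bigD1 k)//= (negPf ks) hA ell2E mulrDl ell2_sumE mulr_suml.
  congr (_ + _); apply: eq_bigr => j _.
  rewrite tensorE (bigD1 k)//= (negPf ks) ffunE eqxx ell2E mulrAC.
  congr (_ * _).
  by apply: eq_bigr => l /negPf nl; rewrite ffunE nl.
rewrite tensorE [RHS](bigD1 k)//= mem_head; congr (_ * _).
by apply: eq_bigr => l /negPf nl; rewrite in_cons nl.
Qed.

(** * Amplitudes of number states and of Psi_n *)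

Lemma sqrtC_nat_neq0 (R : realType) n : (0 < n)%N ->
  (Num.sqrt (n%:R : R))%:C != 0.
Proof. by move=> n0; rewrite fmorph_eq0 gt_eqF// sqrtr_gt0 ltr0n. Qed.

Lemma sqrtC_fact_neq0 (R : realType) n : (Num.sqrt (n`!%:R : R))%:C != 0.
Proof. exact/sqrtC_nat_neq0/fact_gt0. Qed.

Lemma ket_apply (R : realType) (m : nat) (t s : {ffun 'I_m -> nat}) :
  ket t s = (s == t)%:R :> R[i].
Proof.
rewrite /ket tensorE; under eq_bigr do rewrite fock_apply.
case: eqP => [->|/eqP ne]; first by rewrite big1// => k _; rewrite eqxx.
have [k nk] : exists k, s k != t k.
  apply/existsP; rewrite -negb_forall; apply: contra ne => /forallP h.
  by apply/eqP/ffunP => k; exact/eqP.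
by rewrite (bigD1 k)//= (negPf nk) mul0r.
Qed.

(** A tuple of sum n has all entries at most n, so it comes from exactly one index t. *)
Lemma sum_ffun_delta (R : realType) (m n : nat) (G : {ffun 'I_m -> nat} -> R[i])
    (s : {ffun 'I_m -> nat}) :
  \sum_(t : {ffun 'I_m -> 'I_n.+1} | (\sum_k val (t k))%N == n)
     G [ffun k => val (t k)] * (s == [ffun k => val (t k)])%:R =
  G s * ((\sum_k s k)%N == n)%:R.
Proof.
have [sn|sn] := eqVneq (\sum_k s k)%N n; last first.
  rewrite mulr0 big1// => t /eqP tn; case: eqP => [e|]; last by rewrite mulr0.
  suff : (\sum_k s k)%N = n by move/eqP; rewrite (negPf sn).
  by rewrite -tn e; apply: eq_bigr => k _; rewrite ffunE.
pose t0 : {ffun 'I_m -> 'I_n.+1} := [ffun k => inord (s k)].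
have t0E : [ffun k => val (t0 k)] = s.
  apply/ffunP => k; rewrite !ffunE/= inordK// ltnS -sn (bigD1 k)//=.
  exact: leq_addr.
rewrite (bigD1 t0)/=; last first.
  rewrite -[X in _ == X]sn; apply/eqP; apply: eq_bigr => k _.
  by move/ffunP: t0E => /(_ k); rewrite ffunE.
rewrite t0E eqxx big1 ?addr0// => t /andP[_ /eqP ne].
case: eqP => [e|]; rewrite ?mulr0//; case: ne.
by apply/ffunP => k; apply: val_inj; rewrite !ffunE/= e ffunE inord_val.
Qed.

Lemma Psi_apply (R : realType) (m n : nat) (s : {ffun 'I_m -> nat}) :
  Psi m n s = (if (\sum_k s k)%N == n then
    ((Num.sqrt (m%:R ^+ n))%:C)^-1 *
    (Num.sqrt (n`!%:R / (\prod_k (s k)`!)%N%:R))%:C else 0) :> R[i].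
Proof.
rewrite /Psi ell2E ell2_sumE.
pose G (t : {ffun 'I_m -> nat}) : R[i] :=
  (Num.sqrt (n`!%:R / (\prod_k (t k)`!)%N%:R))%:C.
rewrite (eq_bigr (fun t : {ffun 'I_m -> 'I_n.+1} =>
  G [ffun k => val (t k)] * (s == [ffun k => val (t k)])%:R)).
  by rewrite sum_ffun_delta /G; case: eqP => _; rewrite ?mulr1 ?mulr0.
move=> t _; rewrite ell2E ket_apply /G; congr (_%:C * _).
by do 4! congr (_ _); under [in RHS]eq_bigr do rewrite ffunE.
Qed.

(** * The local operators and the SLOCC equivalence *)

(* The images, under the inverse of a local operator, of the number states *)
(* that occur in [Phi_N + sum_n |n>^m].                                    *)
Definition slocc_basis (R : realType) (N r : nat) (p : nat -> R[i])
    (kappa beta : 'I_r -> R[i]) (j : 'I_(N.+1 + r)) : ell2 R nat :=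
  match fintype.split j with
  | inl j => \sum_(i < N.+1 | (i <= j)%N)
               (p (j - i)%N / (Num.sqrt (i`!%:R))%:C) *: fock i
  | inr k => kappa k *: coherent (beta k)
  end.

Lemma slocc_basis_lshift (R : realType) (N r : nat) (p : nat -> R[i])
    (kappa beta : 'I_r -> R[i]) (j : 'I_N.+1) (i : nat) :
  slocc_basis p kappa beta (lshift r j) i =
    (i <= j)%:R * (p (j - i)%N / (Num.sqrt (i`!%:R))%:C).
Proof.
rewrite /slocc_basis (unsplitK (inl j)) ell2_sumE.
have [lij|lji] := leqP i j; last first.
  rewrite mul0r big1// => l lj; rewrite ell2E fock_apply gtn_eqF ?mulr0//.
  exact: leq_ltn_trans lj lji.
rewrite mul1r (bigD1 (inord i)) /= inordK ?lij//;
  try by rewrite (leq_ltn_trans lij).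
rewrite ell2E fock_apply eqxx mulr1 big1 ?addr0// => l /andP[_ nl].
rewrite ell2E fock_apply; case: eqP => [e|]; rewrite ?mulr0//.
by rewrite e inord_val eqxx in nl.
Qed.

Lemma slocc_basis_rshift (R : realType) (N r : nat) (p : nat -> R[i])
    (kappa beta : 'I_r -> R[i]) (k : 'I_r) :
  slocc_basis p kappa beta (rshift N.+1 k) = kappa k *: coherent (beta k).
Proof. by rewrite /slocc_basis (unsplitK (inr k)). Qed.

(** The matrix is block upper triangular. The first block is triangular with diagonal p(0) /
    sqrt(j!). The last one is a Vandermonde matrix in the [beta k], with rows scaled by 1 /
    sqrt((N+1+i)!) and columns by a multiple of [beta k ^+ N.+1], which is where [beta k != 0]
    enters. *)
Lemma slocc_basis_unitmx (R : realType) (N r : nat) (p : nat -> R[i])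
    (kappa beta : 'I_r -> R[i]) :
  p 0%N != 0 -> (forall k, kappa k != 0) ->
  (forall k, beta k != 0) -> injective beta ->
  (\matrix_(i, j) slocc_basis p kappa beta j i : 'M_(N.+1 + r)) \in unitmx.
Proof.
move=> p0 k0 b0 bi; set M := \matrix_(i, j) _.
have dl0 : dlsubmx M = 0.
  apply/matrixP => i j; rewrite !mxE slocc_basis_lshift leqNgt.
  by rewrite (leq_trans (ltn_ord j)) ?mul0r//= leq_addr.
rewrite -[M]submxK dl0 unitmxE det_ublock unitfE mulf_neq0//.
  rewrite -det_tr det_trig.
    apply/prodf_neq0 => i _; rewrite !mxE slocc_basis_lshift leqnn subnn mul1r.
    by rewrite mulf_neq0 ?invr_eq0 ?sqrtC_fact_neq0.
  apply/is_trig_mxP => i j lij; rewrite !mxE slocc_basis_lshift leqNgt lij.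
  by rewrite mul0r.
pose e k : R[i] := (expR (- normc (beta k) ^+ 2 / 2))%:C.
have -> : drsubmx M = diag_mx (\row_i ((Num.sqrt (N.+1 + i)`!%:R)%:C)^-1) *m
    Vandermonde r (\row_k beta k) *m
    diag_mx (\row_k (kappa k * e k * beta k ^+ N.+1)).
  apply/matrixP => i k; rewrite mul_mx_diag mul_diag_mx !mxE slocc_basis_rshift.
  rewrite ell2E [coherent _ _](_ : _ = coherent_coef (beta k) (N.+1 + i)%N)//.
  by rewrite /coherent_coef -/(e k) exprD; ring.
rewrite !det_mulmx !det_diag det_Vandermonde !mulf_neq0//.
- by apply/prodf_neq0 => i _; rewrite mxE invr_eq0 sqrtC_fact_neq0.
- apply/prodf_neq0 => i _; apply/prodf_neq0 => j lij; rewrite !mxE subr_eq0.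
  by apply: contraTneq lij => /bi ->; rewrite ltnn.
- apply/prodf_neq0 => k _; rewrite mxE !mulf_neq0 ?expf_neq0//.
  by rewrite fmorph_eq0 gt_eqF// expR_gt0.
Qed.

Lemma sqrtC_multinomial (R : realType) (m n : nat) (s : 'I_m -> nat) :
  (Num.sqrt (n`!%:R / (\prod_k (s k)`!)%N%:R : R))%:C =
  (Num.sqrt n`!%:R)%:C * \prod_k ((Num.sqrt ((s k)`!%:R : R))%:C)^-1.
Proof.
rewrite sqrtrM ?ler0n// sqrtrV ?ler0n// rmorphM fmorphV/= prodfV.
congr (_ / _).
apply: (big_morph (fun a : nat => (Num.sqrt (a%:R : R))%:C)).
  by move=> a b; rewrite natrM sqrtrM ?ler0n// rmorphM.
by rewrite sqrtr1.
Qed.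

(** Away from [k0] the factors force [s k = t k]; the constraint on the sum then fixes [t k0], so
    each s meets at most one t. *)
Lemma prod_toeplitz (R : realType) (m N : nat) (k0 : 'I_m)
    (p : nat -> R[i]) (s : 'I_m -> nat) (t : 'I_m -> nat) :
  (\sum_k t k = N)%N ->
  \prod_k ((s k <= t k)%N%:R *
    (if k == k0 then p else fun l => (l == 0)%N%:R) (t k - s k)%N) =
  (\sum_k s k <= N)%N%:R * p (N - \sum_k s k)%N *
    (finfun (fun k => if k == k0 then (s k0 + (N - \sum_k s k))%N else s k)
      == finfun t)%:R :> R[i].
Proof.
move=> tN; rewrite (bigD1 k0)//= eqxx.
have [/forallP h|] := boolP [forall k, (k != k0) ==> (s k == t k)].
  rewrite big1 ?mulr1; last first.
    move=> k nk; move: (h k); rewrite nk => /eqP ->.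
    by rewrite (negPf nk) leqnn subnn mulr1.
  have e : (\sum_(k | k != k0) s k = \sum_(k | k != k0) t k)%N.
    by apply: eq_bigr => k nk; move: (h k); rewrite nk => /eqP.
  have sS : (\sum_k s k = s k0 + \sum_(k | k != k0) t k)%N.
    by rewrite (bigD1 k0)//= e.
  have tS : (N = t k0 + \sum_(k | k != k0) t k)%N by rewrite -tN (bigD1 k0).
  rewrite sS {1 3}tS leq_add2r tS subnDr.
  have [le|] := leqP (s k0) (t k0); last by rewrite !mul0r.
  rewrite [X in _ * (nat_of_bool X)%:R](_ : _ = true) ?mulr1//; apply/eqP.
  apply/ffunP => k; rewrite !ffunE; case: eqP => [->|/eqP nk]; first by rewrite subnKC.
  by move: (h k); rewrite nk => /eqP.
rewrite negb_forall => /existsP[k]; rewrite negb_imply => /andP[nk nst].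
(* With truncated subtraction, [t k - s k = 0] only says [t k <= s k]; the other factor gives the
   reverse inequality. *)
rewrite (bigD1 k)//= (negPf nk) subn_eq0.
rewrite -natrM mulnb -eqn_leq (negPf nst) mul0r mulr0.
case: eqP => [/ffunP/(_ k)|]; last by rewrite mulr0.
by rewrite !ffunE (negPf nk) => /eqP; rewrite (negPf nst).
Qed.

Lemma sum_tensor_slocc_basis (R : realType) (m N r : nat) (k0 : 'I_m)
    (p : nat -> R[i]) (kappa : 'I_m -> 'I_r -> R[i]) (beta : 'I_r -> R[i])
    (s : {ffun 'I_m -> nat}) :
  (\sum_(t : {ffun 'I_m -> 'I_N.+1} | (\sum_k val (t k))%N == N)
     tensor (fun k => slocc_basis
       (if k == k0 then p else fun l => (l == 0)%N%:R) (kappa k) beta (lshift r (t k)))) s =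
  (\sum_k s k <= N)%N%:R * p (N - \sum_k s k)%N *
    \prod_k ((Num.sqrt ((s k)`!%:R : R))%:C)^-1.
Proof.
set S := (\sum_k s k)%N; set W := \prod_k _.
pose s' : {ffun 'I_m -> nat} :=
  [ffun k => if k == k0 then (s k0 + (N - S))%N else s k].
(* When S <= N the tuple [s'] has sum N; otherwise both sides vanish. The added indicator brings the
   expression into the form of [sum_ffun_delta]. *)
have -> : (S <= N)%N%:R * p (N - S)%N * W =
    (S <= N)%N%:R * p (N - S)%N * W * ((\sum_k s' k)%N == N)%:R.
  have [SN|] := leqP S N; last by rewrite !mul0r.
  rewrite [X in _ * (nat_of_bool X)%:R](_ : _ = true) ?mulr1//; apply/eqP.
  rewrite (bigD1 k0)//= ffunE eqxx (eq_bigr s); last first.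
    by move=> k /negPf nk; rewrite ffunE nk.
  have SE : S = (s k0 + \sum_(k | k != k0) s k)%N by rewrite /S (bigD1 k0).
  by rewrite addnAC -SE subnKC.
rewrite -(sum_ffun_delta N (fun=> (S <= N)%N%:R * p (N - S)%N * W) s').
rewrite ell2_sumE.
apply: eq_bigr => t /eqP tN; rewrite tensorE.
rewrite mulrAC -(prod_toeplitz k0 p s tN) -big_split/=; apply: eq_bigr => k _.
by rewrite slocc_basis_lshift mulrA.
Qed.

Lemma tensorZ (R : realType) (m : nat) (a : 'I_m -> R[i])
    (x : 'I_m -> ell2 R nat) :
  tensor (fun k => a k *: x k) = (\prod_k a k) *: tensor x.
Proof.
apply: ell2_eq => t; rewrite ell2E !tensorE -big_split/=.
by apply: eq_bigr => k _; rewrite ell2E.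
Qed.

Lemma slocc_equivalent_Phi (R : realType) (m : nat) (k0 : 'I_m) (N r : nat)
    (c : nat -> R[i]) (d beta : 'I_r -> R[i]) :
  c N != 0 -> (forall k, d k != 0) -> (forall k, beta k != 0) ->
  injective beta ->
  slocc_equivalent
    (\sum_(0 <= n < N.+1) c n *: Psi m n +
       \sum_(k < r) d k *: tensor (fun=> coherent (beta k)))
    (Phi m N + \sum_(N.+1 <= n < (N + r).+1) tensor (fun=> fock n)).
Proof.
move=> cN d0 b0 bi.
have m0 : (0 < m)%N := leq_ltn_trans (leq0n _) (ltn_ord k0).
have sm0 n : (Num.sqrt (m%:R ^+ n : R))%:C != 0.
  by rewrite -natrX sqrtC_nat_neq0// expn_gt0 m0.
(* Chosen so that p(N-S) times the product of the 1 / sqrt(s_k!) is c_S times the amplitude of Psi_S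
   at s; p(0) is a nonzero multiple of c_N. *)
pose p l := c (N - l)%N * (Num.sqrt (N - l)`!%:R)%:C /
  (Num.sqrt (m%:R ^+ (N - l)))%:C.
pose pp k : nat -> R[i] := if k == k0 then p else fun l => (l == 0)%N%:R.
(* Scalars on the modes multiply, so each [d i] is placed on one mode only. *)
pose kappa k i := if k == k0 then d i else 1.
pose u k := @slocc_basis R N r (pp k) (kappa k) beta.
have uu k : (\matrix_(i, j) u k j i : 'M_(N.+1 + r)) \in unitmx.
  apply: slocc_basis_unitmx => //.
    rewrite /pp; case: (k =P k0) => _; last by rewrite oner_eq0.
    by rewrite /p subn0 !mulf_neq0 ?invr_eq0 ?sqrtC_fact_neq0.
  by move=> i; rewrite /kappa; case: (k =P k0) => // _; exact: oner_neq0.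
have /choice[A /choice[g hA]] k := invertible_op_basis (uu k).
have [|T hT] := @tensor_op R m _ A g; first by move=> k x; case: (hA k).
exists A, T; split=> //; first by move=> k; case: (hA k).
have Au k j : A k (u k j) = fock j by case: (hA k).
have -> : \sum_(0 <= n < N.+1) c n *: Psi m n =
    \sum_(t : {ffun 'I_m -> 'I_N.+1} | (\sum_k val (t k))%N == N)
      tensor (fun k => u k (lshift r (t k))).
  apply: ell2_eq => s; rewrite sum_tensor_slocc_basis ell2_sumE.
  set S := (\sum_k s k)%N; have [SN|NS] := leqP S N; last first.
    rewrite !mul0r big_nat big1// => n /andP[_ nN].
    by rewrite ell2E Psi_apply -/S gtn_eqF ?mulr0// (leq_ltn_trans _ NS).
  rewrite big_mkord (bigD1 (inord S))//= big1 ?addr0 => [|n nS].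
    rewrite inordK// ell2E Psi_apply -/S eqxx sqrtC_multinomial /p subKn//.
    by rewrite mul1r; ring.
  rewrite ell2E Psi_apply -/S; case: eqP => [e|]; last by rewrite mulr0.
  by rewrite e inord_val eqxx in nS.
have -> : \sum_(k < r) d k *: tensor (fun=> coherent (beta k)) =
    \sum_(i < r) tensor (fun k => u k (rshift N.+1 i)).
  apply: eq_bigr => i _; rewrite [X in _ = tensor X](_ : _ =
      fun k : 'I_m => kappa k i *: coherent (beta i)).
    rewrite tensorZ (bigD1 k0)//= /kappa eqxx big1 ?mulr1// => k /negPf nk.
    by rewrite nk.
  by apply/funext => k; rewrite /u slocc_basis_rshift.
case: hT => _ hT; rewrite linearD !linear_sum/=; congr (_ + _).
  apply: eq_bigr => t _; rewrite hT /ket; congr tensor; apply/funext => k.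
  by rewrite Au ffunE.
rewrite -addSn -{1}[N.+1]add0n big_addn addKn big_mkord.
apply: eq_bigr => i _; rewrite hT; congr tensor; apply/funext => k.
by rewrite Au/= addnC.
Qed.

(** * Action of the beam splitter on number and coherent states *)

(** Some finite set of indices carries all but e of the squared norm. Once M exceeds these indices,
    every finite piece of the tail is disjoint from them and weighs at most e. *)
Lemma l2norm_tail (R : realType) (v : ell2 R nat) (e : R) : 0 < e ->
  exists M0, forall M, (M0 <= M)%N ->
    l2norm (v - \sum_(n < M) v n *: fock n) ^+ 2 <= e.
Proof.
move=> e0.
have [s us hs] : exists2 s, uniq s &
    l2norm v ^+ 2 - e < \sum_(i <- s) normc (v i) ^+ 2.
  apply: contrapT => no.
  have : l2norm v ^+ 2 <= l2norm v ^+ 2 - e.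
    apply: l2norm_sqr_le => s us; rewrite leNgt; apply/negP => h.
    by apply: no; exists s.
  by rewrite lerDl oppr_ge0 leNgt e0.
exists (\max_(i <- s) i).+1 => M sM; apply: l2norm_sqr_le => q uq.
have tailE i : (v - \sum_(n < M) v n *: fock n) i =
    if (i < M)%N then 0 else v i.
  rewrite !ell2E ell2_sumE; case: ltnP => [iM|Mi].
    rewrite (bigD1 (Ordinal iM))//= big1 ?addr0 => [|n ni].
      by rewrite ell2E fock_apply eqxx mulr1 subrr.
    rewrite ell2E fock_apply; case: eqP => [ein|]; last by rewrite mulr0.
    by case/eqP: ni; apply: val_inj.
  rewrite big1 ?subr0// => n _; rewrite ell2E fock_apply gtn_eqF ?mulr0//.
  exact: leq_trans Mi.
pose q' := [seq i <- q | (M <= i)%N].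
have -> : \sum_(i <- q) normc ((v - \sum_(n < M) v n *: fock n) i) ^+ 2 =
    \sum_(i <- q') normc (v i) ^+ 2.
  rewrite big_filter [RHS]big_mkcond; apply: eq_bigr => i _.
  rewrite tailE ltnNge; case: (M <= i)%N => //; last by rewrite normc0 expr0n.
have : \sum_(i <- s ++ q') normc (v i) ^+ 2 <= l2norm v ^+ 2.
  apply: sum_sqr_le_l2norm; rewrite cat_uniq us filter_uniq// andbT/=.
  apply/hasPn => i; rewrite mem_filter => /andP[Mi _]; apply/negP => si.
  have := leq_trans sM Mi; rewrite ltnNge; apply/negP; rewrite negbK.
  exact: leq_bigmax_seq.
by rewrite big_cat/=; lra.
Qed.

(** At t of sum n+1, mode k contributes t_k times a factor independent of k, and the t_k add up to
    n+1. *)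
Lemma sum_creation_Psi (R : realType) (m n : nat) (t : {ffun 'I_m -> nat}) :
  (0 < m)%N ->
  ((Num.sqrt (m%:R : R))%:C)^-1 * \sum_(k < m) creation k (Psi m n) t =
  (Num.sqrt n.+1%:R)%:C * Psi m n.+1 t.
Proof.
move=> m0; set W := \prod_k ((Num.sqrt ((t k)`!%:R : R))%:C)^-1.
have cE k : creation k (Psi m n) t = if (\sum_k t k)%N == n.+1 then
    (t k)%:R * (((Num.sqrt (m%:R ^+ n))%:C)^-1 * (Num.sqrt n`!%:R)%:C * W)
    else 0.
  rewrite /creation; have [t0|] := posnP (t k).
    by rewrite t0 sqrtr0 !mul0r if_same.
  case tk : (t k) => [//|j] _.
  set t' : {ffun 'I_m -> nat} := [ffun l => _].
  have t'k : t' k = j by rewrite ffunE eqxx tk subn1.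
  have t'l l : l != k -> t' l = t l by move=> /negPf nl; rewrite ffunE nl subn0.
  have -> : (\sum_k t k = (\sum_k t' k).+1)%N.
    rewrite (bigD1 k)//= tk (bigD1 k (P := xpredT) (F := t'))//= t'k addSn.
    by congr (_ + _).+1; apply: eq_bigr => l /t'l ->.
  rewrite eqSS Psi_apply sqrtC_multinomial; case: eqP => _;
    last by rewrite mulr0.
  rewrite -!mulrA mulrCA [RHS]mulrCA; congr (_ * _).
  rewrite mulrCA [RHS]mulrCA; congr (_ * _).
  rewrite /W !(bigD1 k (P := xpredT))//= t'k tk factS natrM sqrtrM ?ler0n//.
  rewrite rmorphM/= invfM.
  rewrite (eq_bigr (fun l => ((Num.sqrt ((t l)`!%:R : R))%:C)^-1));
    last by move=> l /t'l ->.
  rewrite !mulrA; congr (_ * _ * _).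
  have -> : j.+1%:R = (Num.sqrt j.+1%:R)%:C * (Num.sqrt j.+1%:R)%:C :> R[i].
    by rewrite -rmorphM -expr2 sqr_sqrtr ?ler0n// rmorph_nat.
  by rewrite mulfK ?sqrtC_nat_neq0.
rewrite (eq_bigr _ (fun k _ => cE k)) Psi_apply sqrtC_multinomial -/W.
case: eqP => [tn|_]; last by rewrite big1 ?mulr0.
rewrite -mulr_suml -natr_sum tn exprS sqrtrM ?ler0n// rmorphM/=.
rewrite factS natrM sqrtrM ?ler0n// rmorphM/= invfM.
have -> : n.+1%:R = (Num.sqrt n.+1%:R)%:C * (Num.sqrt n.+1%:R)%:C :> R[i].
  by rewrite -rmorphM -expr2 sqr_sqrtr ?ler0n// rmorph_nat.
by ring.
Qed.

(** The Gaussian prefactor of [alpha] is the m-th power of that of alpha / sqrt m, and the factorial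
    in the coherent amplitude cancels the one in the multinomial. *)
Lemma coherent_Psi (R : realType) (m : nat) (alpha : R[i])
    (t : {ffun 'I_m -> nat}) : (0 < m)%N ->
  coherent alpha (\sum_k t k)%N * Psi m (\sum_k t k)%N t =
  tensor (fun=> coherent (alpha / (Num.sqrt m%:R)%:C)) t.
Proof.
move=> m0; rewrite Psi_apply eqxx sqrtC_multinomial tensorE.
set S := (\sum_k t k)%N; set W := \prod_k _; set sm := (Num.sqrt m%:R)%:C.
have -> : (Num.sqrt (m%:R ^+ S : R))%:C = sm ^+ S.
  elim: S => [|n ih]; first by rewrite sqrtr1.
  by rewrite !exprS sqrtrM ?ler0n// rmorphM/= ih.
rewrite [coherent alpha S](_ : _ = coherent_coef alpha S)// /coherent_coef.
rewrite (eq_bigr (fun k => (expR (- normc (alpha / sm) ^+ 2 / 2))%:C *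
    ((alpha / sm) ^+ t k * ((Num.sqrt ((t k)`!%:R : R))%:C)^-1)))//.
have -> : (expR (- normc alpha ^+ 2 / 2))%:C =
    (expR (- normc (alpha / sm) ^+ 2 / 2))%:C ^+ m.
  rewrite -rmorphXn -expRM_natl; congr (expR _)%:C.
  rewrite normcM normcV normc_real ger0_norm ?sqrtr_ge0// exprMn exprVn.
  rewrite sqr_sqrtr ?ler0n//; field; by rewrite pnatr_eq0 -lt0n.
rewrite !big_split/= prodr_const card_ord -/W prodrXr -/S expr_div_n.
have := sqrtC_fact_neq0 R S.
by rewrite -!mulrA => f0; do 2! congr (_ * _); rewrite mulrCA mulKf.
Qed.

Definition vacuum_ext (R : realType) (m : nat) (x : ell2 R nat) : modes R m :=
  tensor (fun k : 'I_m => if val k == 0%N then x else fock 0).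

Lemma vacuum_extE (R : realType) (m : nat) (k0 : 'I_m) (x : ell2 R nat) t :
  val k0 = 0%N ->
  vacuum_ext m x t = x (t k0) * [forall k, (k != k0) ==> (t k == 0%N)]%:R.
Proof.
move=> k00; rewrite /vacuum_ext tensorE (bigD1 k0)//= k00 /=; congr (_ * _).
have nk k : k != k0 -> (val k == 0%N) = false.
  by apply: contra_neqF => /eqP k0E; apply: val_inj; rewrite k0E k00.
have [/forallP h|] := boolP [forall k, (k != k0) ==> (t k == 0%N)].
  rewrite big1// => k kk0; rewrite nk// fock_apply.
  by have := h k; rewrite kk0 /= => ->.
rewrite negb_forall => /existsP[k]; rewrite negb_imply => /andP[kk0 tk].
by rewrite (bigD1 k)//= nk// fock_apply (negPf tk) mul0r.
Qed.

Lemma vacuum_ext_linear (R : realType) (m : nat) (k0 : 'I_m) :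
  val k0 = 0%N ->
  exists v : {linear ell2 R nat -> modes R m}, v =1 @vacuum_ext R m.
Proof.
move=> k00.
have linv : linear (@vacuum_ext R m).
  move=> a x y; apply: ell2_eq => t.
  by rewrite !ell2E !(vacuum_extE _ _ k00) !ell2E mulrDl mulrA.
pose vM := GRing.isLinear.Build _ _ _ _ _ linv.
pose v : {linear ell2 R nat -> modes R m} := HB.pack (@vacuum_ext R m) vM.
by exists v.
Qed.

Lemma l2norm_vacuum_ext_le (R : realType) (m : nat) (k0 : 'I_m)
    (x : ell2 R nat) :
  val k0 = 0%N -> l2norm (vacuum_ext m x) ^+ 2 <= l2norm x ^+ 2.
Proof.
move=> k00; apply: l2norm_sqr_le => s us.
pose P (t : {ffun 'I_m -> nat}) := [forall k, (k != k0) ==> (t k == 0%N)].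
pose s' := [seq t k0 | t : {ffun 'I_m -> nat} <- [seq t <- s | P t]].
have -> : \sum_(t <- s) normc (vacuum_ext m x t) ^+ 2 =
    \sum_(i <- s') normc (x i) ^+ 2.
  rewrite big_map big_filter [RHS]big_mkcond; apply: eq_bigr => t _.
  rewrite (vacuum_extE _ _ k00) -/(P t).
  by case: (P t); rewrite ?mulr1// mulr0 normc0 expr0n.
apply: sum_sqr_le_l2norm; rewrite map_inj_in_uniq ?filter_uniq// => t u.
rewrite !mem_filter => /andP[/forallP ht _] /andP[/forallP hu _] e.
apply/ffunP => k; have [->//|kk0] := eqVneq k k0.
by move: (ht k) (hu k); rewrite kk0 => /eqP -> /eqP ->.
Qed.

Lemma vacuum_ext_fock0 (R : realType) (m : nat) :
  vacuum_ext m (fock 0) = ket [ffun=> 0%N] :> modes R m.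
Proof.
by congr tensor; apply/funext => k; rewrite ffunE; case: ifP.
Qed.

Lemma Psi0 (R : realType) (m : nat) : Psi m 0 = ket [ffun=> 0%N] :> modes R m.
Proof.
apply: ell2_eq => t; rewrite Psi_apply ket_apply sqrtC_multinomial.
have -> : (t == [ffun=> 0%N]) = ((\sum_k t k)%N == 0%N).
  rewrite sum_nat_eq0; apply/eqP/forallP => [-> k|h]; first by rewrite ffunE.
  by apply/ffunP => k; rewrite ffunE; apply/eqP/h.
case: eqP => // /eqP; rewrite sum_nat_eq0 => /forallP h.
rewrite expr0 sqrtr1 big1 => [|k _]; first by rewrite !mulr1 invr1.
by have /eqP -> := h k; rewrite fact0 sqrtr1 invr1.
Qed.

Lemma creation_vacuum_ext (R : realType) (m n : nat) (k0 : 'I_m) :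
  val k0 = 0%N ->
  ((Num.sqrt n.+1%:R)%:C *: vacuum_ext m (fock n.+1) : modes R m) =
    creation k0 (vacuum_ext m (fock n)) :> ({ffun 'I_m -> nat} -> R[i]).
Proof.
move=> k00; apply/funext => t; rewrite ell2E /creation !(vacuum_extE _ _ k00).
rewrite !fock_apply !ffunE eqxx subn1.
have -> : [forall k, (k != k0) ==>
      ([ffun l => (t l - (l == k0))%N] k == 0%N)] =
    [forall k, (k != k0) ==> (t k == 0%N)].
  apply: eq_forallb => k; rewrite ffunE; case: eqP => //= _.
  by rewrite subn0.
rewrite !mulrA; congr (_ * _).
case: (t k0) => [|j]; first by rewrite sqrtr0 mul0r mulr0.
by rewrite eqSS/=; case: eqP => [->//|_]; rewrite !mulr0.
Qed.

Lemma beam_splitter_fock (R : realType) (m : nat) (k0 : 'I_m)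
    (U : {linear modes R m -> modes R m}) (n : nat) :
  val k0 = 0%N -> balanced_beam_splitter U ->
  U (vacuum_ext m (fock n)) = Psi m n.
Proof.
move=> k00 [V [[UK VK] _ U0 hU]].
have m0 : (0 < m)%N := leq_ltn_trans (leq0n _) (ltn_ord k0).
elim: n => [|n ih]; first by rewrite vacuum_ext_fock0 U0 Psi0.
(* By induction V Psi_n = |n,0,...,0>, whose image under the creation operator is sqrt(n+1)
   |n+1,0,...,0>, a legitimate square-summable w. *)
have := hU k0 (Psi m n) _ k00.
rewrite -{1}ih UK => /(_ _ (creation_vacuum_ext R n k00)).
rewrite linearZ/= => e; apply: ell2_eq => t.
have := congr1 (fun f => f t) e.
rewrite ell2E => {}e.
apply: (mulfI (sqrtC_nat_neq0 R (ltn0Sn n))); rewrite e.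
rewrite -sum_creation_Psi//; congr (_ * _).
by elim/big_rec2: _ => // k x y _ <-.
Qed.

(** At a fixed t of total S, a truncation of the coherent state beyond S already has the right
    output amplitude, as only the term n = S reaches t. The error is a coordinate of the image of
    the tail, made arbitrarily small because U preserves norms. *)
Lemma beam_splitter_coherent (R : realType) (m : nat) (k0 : 'I_m)
    (U : {linear modes R m -> modes R m}) (alpha : R[i]) :
  val k0 = 0%N -> balanced_beam_splitter U ->
  U (vacuum_ext m (coherent alpha)) =
    tensor (fun=> coherent (alpha / (Num.sqrt m%:R)%:C)).
Proof.
move=> k00 bU; apply: ell2_eq => t.
have m0 : (0 < m)%N := leq_ltn_trans (leq0n _) (ltn_ord k0).
have [v vE] := @vacuum_ext_linear R _ _ k00; rewrite -vE.
set y := coherent alpha; set z := tensor _.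
suff : normc (U (v y) t - z t) ^+ 2 <= 0.
  rewrite le_eqVlt ltNge sqr_ge0 orbF sqrf_eq0 => /eqP/eq0_normc/eqP.
  by rewrite subr_eq0 => /eqP.
apply/ler_addgt0Pl => e /(l2norm_tail y)[M0 hM0].
rewrite addr0; set S := (\sum_k t k)%N.
pose M := maxn M0 S.+1.
have SM : (S < M)%N by rewrite leq_maxr.
apply: le_trans (hM0 M (leq_maxl _ _)); set q := y - _.
apply: le_trans (l2norm_vacuum_ext_le q k00).
case: (bU) => _ [_ nU _ _]; rewrite -nU.
suff -> : U (v y) t - z t = U (vacuum_ext m q) t by exact: sqr_normc_le_l2norm.
rewrite -vE /q !linearB !ell2E; congr (_ - _).
rewrite !linear_sum ell2_sumE (bigD1 (Ordinal SM))// big1 => [|n nS].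
  rewrite !linearZ ell2E/= vE [RHS]addr0 (beam_splitter_fock _ k00)//.
  exact: esym (coherent_Psi _ _ m0).
rewrite !linearZ ell2E/= vE (beam_splitter_fock _ k00)// Psi_apply.
case: eqP => [Sn|_]; last by rewrite mulr0.
by case/eqP: nS; apply: val_inj.
Qed.

(** * The output state and its equivalence class *)

Theorem mainTheorem7 (R : realType) (m : nat) (hm : (1 < m)%N)
    (N r : nat) (c : nat -> R[i]) (d alpha : 'I_r -> R[i]) (nrm : R[i])
    (hc : c N != 0)
    (hd : forall k, d k != 0)
    (halpha : injective (fun k => coherent (alpha k)))
    (halpha0 : forall k, alpha k != 0) :
  let psi : ell2 R nat :=
    nrm^-1 *: (\sum_(0 <= n < N.+1) c n *: fock n
                + \sum_(k < r) d k *: coherent (alpha k)) in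
  let beta k := alpha k / (Num.sqrt m%:R)%:C in
  let PsiOut : modes R m :=
    nrm^-1 *: (\sum_(0 <= n < N.+1) c n *: Psi m n
                + \sum_(k < r) d k *: tensor (fun=> coherent (beta k))) in
  l2norm psi = 1 ->
  (forall U : {linear modes R m -> modes R m}, balanced_beam_splitter U ->
     U (tensor (fun k => if val k == 0%N then psi else fock 0)) = PsiOut) /\
  slocc_equivalent PsiOut
    (Phi m N + \sum_(N.+1 <= n < (N + r).+1) tensor (fun=> fock n)).
Proof.
move=> psi beta PsiOut npsi.
have m0 : (0 < m)%N := ltnW hm.
pose k0 := Ordinal m0; have k00 : val k0 = 0%N by [].
(* Since the inverse of 0 is 0, [nrm = 0] would make [psi] vanish, against its unit norm. *)
have nrm0 : nrm != 0.
  apply/eqP => e; suff : l2norm psi ^+ 2 <= 0.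
    by rewrite npsi expr1n lt_geF ?ltr01.
  rewrite /psi e invr0 scale0r; apply: l2norm_sqr_le => s _.
  by rewrite big1// => i _; rewrite ell2E normc0 expr0n.
split=> [U bU|].
  have [v vE] := @vacuum_ext_linear R _ _ k00.
  rewrite -[tensor _]/(vacuum_ext m psi) -vE /psi /PsiOut.
  rewrite linearZ/= linearZ/= linearD/= linearD/=.
  congr (_ *: (_ + _)); rewrite linear_sum/= linear_sum/=;
    apply: eq_bigr => i _.
    by rewrite linearZ/= linearZ/= vE (beam_splitter_fock _ k00).
  by rewrite linearZ/= linearZ/= vE (beam_splitter_coherent _ k00).
(* The normalization is absorbed into the coefficients, which stay nonzero where required. *)
have -> : PsiOut = \sum_(0 <= n < N.+1) (nrm^-1 * c n) *: Psi m n +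
    \sum_(k < r) (nrm^-1 * d k) *: tensor (fun=> coherent (beta k)).
  rewrite /PsiOut scalerDr !scaler_sumr.
  by congr (_ + _); apply: eq_bigr => i _; rewrite scalerA.
have sm0 := sqrtC_nat_neq0 R m0.
apply: (slocc_equivalent_Phi k0) => [|k|k|k l].
- by rewrite mulf_neq0 ?invr_eq0.
- by rewrite mulf_neq0 ?invr_eq0.
- by rewrite mulf_neq0 ?invr_eq0.
- by move/(divIf sm0) => e; apply: halpha; rewrite /= e.
Qed.
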